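(* Let $t,R,\ell$ be positive integers and $k=2^t$. Let $f$ be given by a level-4 pseudo-expectation functional $\tilde{\mathbb E}_f$ on polynomials in the variables $\{\hat f_\alpha\}$, $\alpha\in\{0,\dots,k-1\}^R$ with $|\alpha|\le\ell$, satisfying $\tilde{\mathbb E}_f\|f\|^4\le1$. Let $\tau=\tilde{\mathbb E}_f\sum_{r=1}^R(\mathrm{Inf}_rf)^2$. Then \[\tilde{\mathbb E}_f\,\mathbb E_{\mathcal X}f^4=\tilde{\mathbb E}_f\,\mathbb E_{\mathcal Y}f^4\pm k^{O(\ell)}\sqrt\tau,\] i.e. there is an absolute constant $C_0$ such that $|\tilde{\mathbb E}_f\mathbb E_{\mathcal X}f^4-\tilde{\mathbb E}_f\mathbb E_{\mathcal Y}f^4|\le k^{C_0\ell}\sqrt\tau$.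
   Context: For $\alpha\in\{0,\dots,k-1\}^R$, $|\alpha|$ is the number of nonzero entries. $f$ denotes the formal multilinear polynomial $f=\sum_{|\alpha|\le\ell}\hat f_\alpha\prod_{r=1}^R Z_{r,\alpha_r}$ evaluated on a sequence of ensembles $Z=(Z_{r,i})_{r\in[R],\,0\le i<k}$. Ensemble $\mathcal X$: identify $\{0,\dots,k-1\}$ with the characters $\chi_0,\dots,\chi_{k-1}$ of $\mathrm{GF}(2)^t$ ($\chi_0\equiv1$), sample $x$ uniformly from $(\mathrm{GF}(2)^t)^R$ and set $X_{r,i}=\chi_i(x_r)$. Ensemble $\mathcal Y$: $Y_{r,0}\equiv1$ and $Y_{r,j}$ ($j\ge1$) are independent unbiased $\{\pm1\}$ variables. Then $\mathbb E_{\mathcal X}f^4$ and $\mathbb E_{\mathcal Y}f^4$ are degree-4 polynomials in the coefficients $\hat f_\alpha$. Also $\|f\|^2=\sum_\alpha\hat f_\alpha^2$ and $\mathrm{Inf}_rf=\sum_{\alpha:\alpha_r\ne0}\hat f_\alpha^2$. A level-4 pseudo-expectation functional is a linear map from polynomials of degree at most 4 in the variables to $\mathbb R$ with $\tilde{\mathbb E}[1]=1$ and $\tilde{\mathbb E}[P^2]\ge0$ for all $P$ of degree at most 2. *)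

(* Defs.v *)
From HB Require Import structures.
From mathcomp Require Import all_boot all_order all_algebra.
From mathcomp Require Import mpoly.
From mathcomp Require Import reals.
Set Implicit Arguments. Unset Strict Implicit. Unset Printing Implicit Defensive.
Import Order.TTheory GRing.Theory Num.Theory.
Local Open Scope ring_scope.

Definition weight (R k : nat) (a : {ffun 'I_R -> 'I_k}) : nat :=
  #|[pred r | nat_of_ord (a r) != 0%N]|.

Definition Alpha (R k l : nat) : finType :=
  {a : {ffun 'I_R -> 'I_k} | (weight a <= l)%N}.

Definition nvar (R k l : nat) : nat := #|Alpha R k l|.

Definition FPoly (F : realType) (R k l : nat) := {mpoly F[nvar R k l]}.

Definition fhat (F : realType) (R k l : nat) (a : Alpha R k l) : FPoly F R k l :=
  'X_(enum_rank a).

(* Level-4 pseudo-expectation: linear on polynomials of degree <= 4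
   (msize p = total degree + 1), normalized, nonnegative on squares of
   polynomials of degree <= 2. *)
Definition pseudo_exp4 (F : realType) (n : nat) (L : {mpoly F[n]} -> F) : Prop :=
  [/\ (forall p q : {mpoly F[n]}, (msize p <= 5)%N -> (msize q <= 5)%N ->
          L (p + q) = L p + L q),
      (forall (c : F) (p : {mpoly F[n]}), (msize p <= 5)%N -> L (c *: p) = c * L p),
      L 1 = 1 &
      forall P : {mpoly F[n]}, (msize P <= 3)%N -> 0 <= L (P * P)].

(* Characters of GF(2)^t, indexed by i in {0,...,2^t-1} via binary expansion:
   chi_i(y) = (-1)^{<bits i, bits y>}; chi_0 = 1. *)
Definition bit (j m : nat) : nat := odd (m %/ 2 ^ j).
Definition chi (F : realType) (t : nat) (i y : 'I_(2 ^ t)) : F :=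
  (-1) ^+ (\sum_(j < t) bit j i * bit j y)%N.

Definition f_on (F : realType) (R k l : nat) (Z : 'I_R -> 'I_k -> F) : FPoly F R k l :=
  \sum_(a : Alpha R k l) (\prod_(r < R) Z r ((val a) r)) *: fhat F a.

Definition EX_f4 (F : realType) (t R l : nat) : FPoly F R (2 ^ t) l :=
  (((2 ^ t) ^ R)%N%:R)^-1 *:
  \sum_(x : {ffun 'I_R -> 'I_(2 ^ t)})
     (f_on l (fun r i => chi F i (x r))) ^+ 4.

(* E_Y f^4 : Y_{r,0} = 1, Y_{r,j} (j >= 1) independent uniform +-1
   (we average over all sign patterns indexed by 'I_R x 'I_k; the j = 0
   coordinates are ignored, which does not change the average). *)
Definition Yval (F : realType) (k : nat) (s : bool) (j : 'I_k) : F :=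
  if nat_of_ord j == 0%N then 1 else (-1) ^+ s.

Definition EY_f4 (F : realType) (R k l : nat) : FPoly F R k l :=
  ((2 ^ (R * k))%N%:R)^-1 *:
  \sum_(y : {ffun 'I_R -> {ffun 'I_k -> bool}})
     (f_on l (fun r j => Yval F (y r j) j)) ^+ 4.

Definition f_normsq (F : realType) (R k l : nat) : FPoly F R k l :=
  \sum_(a : Alpha R k l) fhat F a ^+ 2.

Definition f_Inf (F : realType) (R k l : nat) (r : 'I_R) : FPoly F R k l :=
  \sum_(a : Alpha R k l | nat_of_ord ((val a) r) != 0%N) fhat F a ^+ 2.

(* Main.v *)
Require Import Defs.
From HB Require Import structures.
From mathcomp Require Import all_boot all_order all_algebra.
From mathcomp Require Import mpoly.
From mathcomp Require Import reals.
From mathcomp Require Import ring lra zify.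
Import Order.TTheory GRing.Theory Num.Theory.
Local Open Scope ring_scope.

Set Implicit Arguments. Unset Strict Implicit. Unset Printing Implicit Defensive.

(** Both fourth moments are sums of [f_a f_b f_c f_d] over the quadruples on which
    a 0/1 relation holds at every coordinate, and at a coordinate where [a] and [b]
    agree both relations just say that [c] and [d] agree. So the coefficients
    depend only on the "keys" of the pairs [(a, b)] and [(c, d)], obtained by
    erasing the coordinates where the two entries agree. Writing [H_u] for the sum
    of [f_a f_b] over the pairs with key [u], the difference of the moments is
    [sum_(u, v) E(u, v) H_u H_v] with few [v] for each [u], and [E(u, v)] vanishes
    unless one of the keys has a coordinate at which both entries are nonzero. By
    Cauchy-Schwarz it remains to bound [sum_u L(H_u^2)]. Exchanging second entries,
    [f_a f_b f_c f_d] is at most [(f_a^2 f_d^2 + f_b^2 f_c^2) / 2] under [L]; few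
    pairs [(b, c)] go with given [(a, d)], and if the common key of [(a, b)] and
    [(c, d)] has a coordinate with two nonzero entries, the supports of [a] and [d]
    meet there, so that those terms are paid for by the influences. *)

(** For [tau > 0] the two terms balance at [c = 1 / sqrt tau]. For [tau = 0] only [A / c] remains,
    and a large [c] rules out [x > 0]. *)
Lemma le_sqrt_of_weighted (F : realType) (x A tau : F) : 0 <= A -> 0 <= tau ->
  (forall c : F, 0 < c -> x <= A * (c * tau + c^-1)) ->
  x <= 2 * A * Num.sqrt tau.
Proof.
move=> A0; rewrite le_eqVlt => /predU1P[<-|tau0] H.
  rewrite sqrtr0 mulr0 leNgt; apply/negP => x0.
  have A1 : 0 < A + 1 by lra.
  have c0 : 0 < (A + 1) / x by rewrite divr_gt0.
  have := H _ c0; rewrite mulr0 add0r invf_div mulrA ler_pdivlMr // => H1.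
  nra.
have s0 : 0 < Num.sqrt tau by rewrite sqrtr_gt0.
have si0 : 0 < (Num.sqrt tau)^-1 by rewrite invr_gt0.
have := H _ si0; rewrite invrK -{2}(sqr_sqrtr (ltW tau0)) expr2 mulKf ?gt_eqF //.
lra.
Qed.

(** * Fourth moments of products of random signs *)

Section Moments.
Variable F : realType.

Lemma sum_sign (n : nat) : \sum_(s : bool) (-1 : F) ^+ (n * s) = 2 * (~~ odd n)%:R.
Proof.
rewrite big_bool /= muln1 muln0 expr0 -signr_odd.
by case: (odd n) => /=; rewrite ?expr0 ?expr1; lra.
Qed.

Lemma sum_sign_ffun (J : finType) (n : J -> nat) :
  \sum_(s : {ffun J -> bool}) (-1 : F) ^+ (\sum_j n j * s j)
  = (2 ^ #|J|)%:R * [forall j, ~~ odd (n j)]%:R.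
Proof.
under eq_bigr do rewrite -prodrXr.
rewrite -(bigA_distr_bigA (fun j (b : bool) => (-1 : F) ^+ (n j * b))) /=.
under eq_bigr do rewrite sum_sign.
rewrite big_split /= prodr_const natrX; congr (_ * _).
case: forallP => [H|/forallP].
  by rewrite big1 // => j _; rewrite H.
rewrite negb_forall => /existsP[j /negbTE Hj].
by rewrite (bigD1 j) //= Hj mul0r.
Qed.

(** The codeword [c i] stands for the character [s -> (-1)^<c i, s>] on sign patterns; the relation
    says that the product of the four characters is trivial. *)
Definition even4 (k : nat) (J : finType) (c : 'I_k -> J -> bool)
    (i1 i2 i3 i4 : 'I_k) : bool :=
  [forall j, ~~ (c i1 j (+) c i2 j (+) c i3 j (+) c i4 j)].

(** Orthogonality of characters. The sample space is only assumed to be in bijection with the sign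
    patterns, so that one statement serves both ensembles. *)
Lemma moment4 (k : nat) (J Om : finType) (c : 'I_k -> J -> bool)
    (s : Om -> {ffun J -> bool}) (i1 i2 i3 i4 : 'I_k) :
  bijective s ->
  let z y i : F := (-1) ^+ (\sum_j c i j * s y j) in
  (#|Om|%:R)^-1 * \sum_y z y i1 * z y i2 * (z y i3 * z y i4)
  = (even4 c i1 i2 i3 i4)%:R.
Proof.
move=> bs z.
have cO : #|Om| = (2 ^ #|J|)%N.
  by rewrite (bij_eq_card bs) card_ffun card_bool.
pose n j := (c i1 j + c i2 j + (c i3 j + c i4 j))%N.
have -> : \sum_y z y i1 * z y i2 * (z y i3 * z y i4)
    = \sum_(u : {ffun J -> bool}) (-1 : F) ^+ (\sum_j n j * u j).
  rewrite [RHS](reindex s) /=; last exact: onW_bij.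
  apply: eq_bigr => y _; rewrite /z -!exprD -!big_split /=.
  by congr (_ ^+ _); apply: eq_bigr => j _; rewrite /n; ring.
rewrite sum_sign_ffun cO mulKf ?pnatr_eq0 ?expn_eq0 //.
congr (_%:R); congr (nat_of_bool _); apply: eq_forallb => j.
by rewrite /n !oddD !oddb !addbA.
Qed.

End Moments.

(** * The parity relation of an injective code *)

Section Even4.
Variables (k : nat) (J : finType) (c : 'I_k -> J -> bool).
Hypothesis c_inj : forall i j, c i =1 c j -> i = j.

Lemma even4E i j i' j' : even4 c i j i' j' = even4 c i' j' i j.
Proof.
apply: eq_forallb => x.
by case: (c i x); case: (c j x); case: (c i' x); case: (c j' x).
Qed.

Lemma even4_swap i j i' j' : even4 c i j i' j' = even4 c j i i' j'.
Proof.
apply: eq_forallb => x.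
by case: (c i x); case: (c j x); case: (c i' x); case: (c j' x).
Qed.

Lemma even4_mid i j i' j' : even4 c i j i' j' = even4 c i i' j j'.
Proof.
apply: eq_forallb => x.
by case: (c i x); case: (c j x); case: (c i' x); case: (c j' x).
Qed.

Lemma even4_diag i j j' : even4 c i i j j' = (j == j').
Proof.
apply/forallP/eqP => [H|-> x]; last by rewrite addbb addFb addbb.
by apply: c_inj => x; have := H x; rewrite addbb addFb => /negbTE/addbP /=;
   case: (c j x); case: (c j' x).
Qed.

Lemma even4_common i j j' : even4 c i j i j' = (j == j').
Proof. by rewrite even4_mid even4_diag. Qed.

Lemma even4_uniq i j i' a b : even4 c i j i' a -> even4 c i j i' b -> a = b.
Proof.
move=> /forallP Ha /forallP Hb; apply: c_inj => x.
by move: (Ha x) (Hb x); case: (c i x); case: (c j x); case: (c i' x);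
  case: (c a x); case: (c b x).
Qed.

End Even4.

(** * Block sums of a positive semidefinite kernel *)

Section BlockKernel.
Variables (F : realType) (P K : finType) (key : P -> K) (T : P -> P -> F).
Hypothesis Tsym : forall p q, T p q = T q p.
Hypothesis Tpsd : forall c : P -> F, 0 <= \sum_p \sum_q c p * c q * T p q.

(** For the kernel [L (f_a f_b f_c f_d)] this is [L (H_u H_v)]. *)
Definition block (u v : K) : F := \sum_(p | key p == u) \sum_(q | key q == v) T p q.

Lemma block_sym u v : block u v = block v u.
Proof.
rewrite /block exchange_big /=; apply: eq_bigr => q _.
by apply: eq_bigr => p _; rewrite Tsym.
Qed.

Lemma blockE u v : block u v =
  \sum_p \sum_q (key p == u)%:R * (key q == v)%:R * T p q.
Proof.
rewrite /block big_mkcond; apply: eq_bigr => p _.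
case: eqP => _; last by rewrite big1 // => q _; rewrite !mul0r.
rewrite big_mkcond; apply: eq_bigr => q _.
by case: eqP => _; rewrite ?mul1r ?mulr0 ?mul0r.
Qed.

Lemma block_quad u v (x y : F) :
  0 <= x ^+ 2 * block u u + 2 * (x * y) * block u v + y ^+ 2 * block v v.
Proof.
have -> : 2 * (x * y) * block u v
    = x * y * block u v + x * y * block v u.
  by rewrite (block_sym v u); ring.
rewrite !blockE !mulr_sumr -!big_split /=.
have := Tpsd (fun p => x * (key p == u)%:R + y * (key p == v)%:R).
congr (_ <= _); apply: eq_bigr => p _.
rewrite !mulr_sumr -!big_split /=; apply: eq_bigr => q _; ring.
Qed.

Lemma block_ge0 u : 0 <= block u u.
Proof. by have := block_quad u u 1 0; lra. Qed.

(** The quadratic form of the two blocks at [(c, 1)] and [(c, -1)], divided by [c]. *)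
Lemma block_le u v (c : F) : 0 < c ->
  2 * `|block u v| <= c * block u u + c^-1 * block v v.
Proof.
move=> c0; have ci0 : 0 < c^-1 by rewrite invr_gt0.
have H e : e ^+ 2 = 1 -> 0 <= c * block u u + 2 * e * block u v + c^-1 * block v v.
  move=> e2; have := mulr_ge0 (ltW ci0) (block_quad u v c e).
  by congr (_ <= _); rewrite e2; field; rewrite gt_eqF.
have := H 1 (expr1n _ _); have := H (-1) (etrans (sqrrN _) (expr1n _ _)).
by case: (ger0P (block u v)) => _; lra.
Qed.

(* The weights [c] and [1/c] are distributed so that [c] always falls on a class
   in [I]. *)
Lemma block_form_le (E : K -> K -> F) (I : pred K) (W c : F) :
  0 <= W ->
  (forall u v, E u v = E v u) ->
  (forall u v, E u v != 0 -> I u || I v) ->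
  (forall p, \sum_(v | [exists q, key q == v]) `|E (key p) v| <= W) ->
  0 < c ->
  `| \sum_p \sum_q E (key p) (key q) * T p q |
    <= W * (c * \sum_(u | I u) block u u + c^-1 * \sum_u block u u).
Proof.
move=> W0 Esym EI EW c0; have ci0 : 0 < c^-1 by rewrite invr_gt0.
(* Only keys attained by some index are kept, since the row bound [W] covers no others. *)
pose rl u := [exists q, key q == u].
have rlk p : rl (key p) by apply/existsP; exists p.
have -> : \sum_p \sum_q E (key p) (key q) * T p q
    = \sum_(u | rl u) \sum_(v | rl v) E u v * block u v.
  rewrite (partition_big key rl) //=; apply: eq_bigr => u _.
  under eq_bigr => p /eqP -> do
    rewrite (partition_big key rl) //=.
  rewrite exchange_big /=; apply: eq_bigr => v _.
  rewrite /block mulr_sumr; apply: eq_bigr => p _.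
  by rewrite mulr_sumr; apply: eq_bigr => q /eqP ->.
pose w u := (c * (I u)%:R + c^-1) * block u u.
have w0 u : 0 <= w u.
  by rewrite mulr_ge0 ?block_ge0 // addr_ge0 ?mulr_ge0 ?ler0n // ltW.
have termle u v : `|E u v * block u v| <= 2^-1 * (`|E u v| * w u + `|E v u| * w v).
  rewrite normrM (Esym v u); have [->|Euv] := eqVneq (E u v) 0.
    by rewrite normr0 !mul0r addr0 mulr0.
  rewrite -mulrDr mulrCA ler_wpM2l //.
  have Bu := block_ge0 u; have Bv := block_ge0 v.
  have ltci (x : F) : 0 <= x -> 0 <= c^-1 * x by apply: mulr_ge0; apply: ltW.
  have ltc (x : F) : 0 <= x -> 0 <= c * x by apply: mulr_ge0; apply: ltW.
  have := ltci _ Bu; have := ltci _ Bv; have := ltc _ Bu; have := ltc _ Bv.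
  rewrite /w; case/orP: (EI _ _ Euv) => ->.
    have := block_le u v c0; case: (I v) => /=; lra.
  have := block_le v u c0; rewrite block_sym; case: (I u) => /=; lra.
apply: (le_trans (ler_norm_sum _ _ _)).
apply: (@le_trans _ _ (\sum_(u | rl u) \sum_(v | rl v)
     2^-1 * (`|E u v| * w u + `|E v u| * w v))).
  apply: ler_sum => u _; apply: (le_trans (ler_norm_sum _ _ _)).
  by apply: ler_sum => v _; apply: termle.
(* The two halves agree after exchanging the sums, so that only row sums of [E] remain. *)
have -> : \sum_(u | rl u) \sum_(v | rl v) 2^-1 * (`|E u v| * w u + `|E v u| * w v)
   = \sum_(u | rl u) \sum_(v | rl v) `|E u v| * w u.
  under eq_bigr do rewrite -mulr_sumr big_split /=.
  rewrite -mulr_sumr big_split /=.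
  have -> : \sum_(u | rl u) \sum_(v | rl v) `|E v u| * w v
    = \sum_(u | rl u) \sum_(v | rl v) `|E u v| * w u by rewrite exchange_big.
  by field.
apply: (@le_trans _ _ (\sum_(u | rl u) W * w u)).
  apply: ler_sum => u /existsP[p /eqP <-].
  by rewrite -mulr_suml ler_wpM2r.
rewrite -mulr_sumr.
rewrite ler_wpM2l // (@le_trans _ _ (\sum_u w u)) //.
  by rewrite [leLHS]big_mkcond ler_sum // => u _; case: ifP.
rewrite /w; under eq_bigr do rewrite mulrDl.
rewrite big_split /= -mulr_sumr lerD2r mulr_sumr [leRHS]big_mkcond.
by apply: ler_sum => u _; case: (I u); rewrite ?mulr1 // mulr0 mul0r.
Qed.

End BlockKernel.

(** * Multi-indices, their supports and the keys of pairs *)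

Section MultiIndices.
Variables (R k l : nat) (z : 'I_k).
Hypothesis z0 : nat_of_ord z = 0%N.
Local Notation A := (Alpha R k l).
Local Notation Key := {ffun 'I_R -> 'I_k * 'I_k}.

Definition supp (a : A) : {set 'I_R} := [set r | val a r != z].

Lemma in_supp (a : A) r : (r \in supp a) = (nat_of_ord (val a r) != 0%N).
Proof. by rewrite inE -(inj_eq val_inj) /= z0. Qed.

Lemma card_supp (a : A) : (#|supp a| <= l)%N.
Proof.
apply: leq_trans (valP a); rewrite /weight leq_eqVlt; apply/orP; left.
by apply/eqP/eq_card => r; rewrite in_supp inE.
Qed.

Lemma card_supp2 (a d : A) : (#|supp a :|: supp d| <= 2 * l)%N.
Proof.
by rewrite mul2n -addnn (leq_trans (leq_card_setU _ _)) // leq_add ?card_supp.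
Qed.

(** Both counts below use this: the objects inject into the functions equal to [z] off a small set
    [S], of which there are [k ^ #|S|]. *)
Lemma card_le_supported (T : finType) (D : pred T) (f : T -> {ffun 'I_R -> 'I_k})
    (S : {set 'I_R}) :
  {in D &, injective f} ->
  (forall x r, D x -> r \notin S -> f x r = z) ->
  (#|D| <= k ^ #|S|)%N.
Proof.
move=> fi fS; rewrite -(card_in_imset fi).
have -> : (k ^ #|S| = #|pffun_on z S [pred i : 'I_k | true]|)%N.
  by rewrite card_pffun_on; congr (_ ^ _)%N; rewrite -[LHS]card_ord; apply: eq_card.
apply/subset_leq_card/subsetP => _ /imsetP[x Dx ->].
apply/pffun_onP; split=> //; apply/supportP => r; exact: fS.
Qed.

(** Erasure is encoded by [(z, z)]; this is unambiguous because a pair that survives has two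
    distinct entries. *)
Definition key (p : A * A) : Key :=
  [ffun r => if val p.1 r == val p.2 r then (z, z) else (val p.1 r, val p.2 r)].

Definition doubly (u : Key) : bool := [exists r, ((u r).1 != z) && ((u r).2 != z)].

Definition meet (a d : A) : bool := [exists r, (r \in supp a) && (r \in supp d)].

(** * Diagonal blocks bounded by exchanging second entries *)

Section Swap.
Variables (F : realType) (T : A * A -> A * A -> F).
Hypothesis Tsym : forall p q, T p q = T q p.
Hypothesis Trot : forall a b c d, T (a, b) (c, d) = T (a, d) (b, c).
Hypothesis Tpsd : forall c : A * A -> F, 0 <= \sum_p \sum_q c p * c q * T p q.

Local Notation N a d := (T (a, d) (a, d)).

Lemma kernel_self_ge0 (a d : A) : 0 <= N a d.
Proof.
have := Tpsd (fun p => (p == (a, d))%:R); rewrite (bigD1 (a, d)) //=.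
rewrite [X in _ + X]big1 ?addr0; last first.
  by move=> p /negbTE ->; rewrite big1 // => q _; rewrite !mul0r.
rewrite (bigD1 (a, d)) //= [X in _ + X]big1 ?addr0 ?eqxx ?mul1r //.
by move=> p /negbTE ->; rewrite mulr0 mul0r.
Qed.

Lemma kernel_self_sym (a d : A) : N a d = N d a.
Proof. by rewrite Trot [RHS]Trot Tsym. Qed.

(** After the rotation this is positivity on the difference of the indicators of [(a, d)] and
    [(b, c)], that is, [L ((f_a f_d - f_b f_c)^2) >= 0]. If the two pairs coincide, that difference
    vanishes and equality holds trivially. *)
Lemma kernel_le p q : T p q <= 2^-1 * (N p.1 q.2 + N p.2 q.1).
Proof.
case: p q => [a b] [c d] /=; rewrite Trot.
have [[-> ->]|ne] := eqVneq (a, d) (b, c).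
  lra.
pose x (p : A * A) : F := (p == (a, d))%:R - (p == (b, c))%:R.
have := Tpsd x.
have S (p : A * A) : \sum_q x p * x q * T p q = x p * (T p (a, d) - T p (b, c)).
  rewrite (bigD1 (a, d)) //= (bigD1 (b, c)) ?(eq_sym (b, c)) //= big1.
    by rewrite /x !eqxx (negbTE ne) (eq_sym (b, c)) (negbTE ne) /=; ring.
  by move=> q /andP[/negbTE q1 /negbTE q2]; rewrite /x q1 q2 subrr mulr0 mul0r.
under eq_bigr do rewrite S.
rewrite (bigD1 (a, d)) //= (bigD1 (b, c)) ?(eq_sym (b, c)) //= big1; last first.
  by move=> q /andP[/negbTE q1 /negbTE q2]; rewrite /x q1 q2 subrr mul0r.
rewrite /x !eqxx (negbTE ne) (eq_sym (b, c)) (negbTE ne) /= (Tsym (b, c) (a, d)).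
lra.
Qed.

(* The swap [T (a, b) (c, d) = T (a, d) (b, c)] turns the diagonal block of a key
   into terms controlled by the squares [N a d]; for given [a] and [d] the index
   [b] vanishes off the supports of [a] and [d], and [c] is determined by [b]. *)
Lemma sum_block_le (I : pred Key) (Q : rel A) :
  (forall a b c d, key (a, b) = key (c, d) -> I (key (a, b)) -> Q a d) ->
  \sum_(u | I u) block key T u u
    <= (k ^ (2 * l))%:R * \sum_a \sum_(d | Q a d) N a d.
Proof.
move=> IQ.
have -> : \sum_(u | I u) block key T u u
    = \sum_(p | I (key p)) \sum_(q | key q == key p) T p q.
  rewrite [RHS](partition_big key I) //=; apply: eq_bigr => u Iu.
  rewrite /block; apply: eq_big => [p|p /eqP->] //.
  by apply/idP/andP => [/eqP->|[]//].
pose S1 := \sum_(p | I (key p)) \sum_(q | key q == key p) N p.1 q.2.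
(* The two halves of [kernel_le] contribute equally, by exchanging [p] and [q]. *)
have S2E : \sum_(p | I (key p)) \sum_(q | key q == key p) N p.2 q.1 = S1.
  rewrite (exchange_big_dep (fun q => I (key q))) /=; last by move=> p q + /eqP->.
  apply: eq_bigr => q Iq; apply: eq_big => [p|p _]; last exact: kernel_self_sym.
  by rewrite eq_sym andb_idl // => /eqP ->.
apply: (@le_trans _ _ S1).
  have -> : S1 = \sum_(p | I (key p)) \sum_(q | key q == key p)
      2^-1 * (N p.1 q.2 + N p.2 q.1).
    under [RHS]eq_bigr do rewrite -mulr_sumr big_split /=.
    by rewrite -mulr_sumr big_split /= S2E -/S1; field.
  by apply: ler_sum => p _; apply: ler_sum => q _; apply: kernel_le.
(* With [a] and [d] outermost, it remains to count the pairs [(b, c)]. *)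
have -> : S1 = \sum_a \sum_d \sum_b \sum_c
    (I (key (a, b)) && (key (c, d) == key (a, b)))%:R * N a d.
  rewrite /S1 big_mkcond -(pair_bigA _ (fun a b => if I (key (a, b)) then
    \sum_(q | key q == key (a, b)) N a q.2 else 0)) /=.
  apply: eq_bigr => a _; rewrite exchange_big /=; apply: eq_bigr => b _.
  case: (I _); last by rewrite big1 // => d _; rewrite big1 // => c _; rewrite mul0r.
  rewrite big_mkcond -(pair_bigA _ (fun c d => if key (c, d) == key (a, b) then
    N a d else 0)) /= exchange_big /=; apply: eq_bigr => d _; apply: eq_bigr => c _.
  by case: (_ == _); rewrite ?mul1r ?mul0r.
rewrite mulr_sumr; apply: ler_sum => a _.
rewrite mulr_sumr [leRHS]big_mkcond; apply: ler_sum => d _.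
rewrite pair_bigA -mulr_suml -natr_sum /=.
pose D := [pred x : A * A | I (key (a, x.1)) && (key (x.2, d) == key (a, x.1))].
have -> : (\sum_(x : A * A) (I (key (a, x.1)) && (key (x.2, d) == key (a, x.1))) = #|D|)%N.
  by rewrite -sum1_card [RHS]big_mkcond; apply: eq_bigr => x _; rewrite inE; case: (_ && _).
case: (boolP (Q a d)) => [_|/negP nQ]; last first.
  rewrite eq_card0 ?mul0r // => -[b c]; rewrite inE /=.
  by apply/negP => /andP[Ib /eqP E]; apply: nQ; apply: IQ (esym E) Ib.
rewrite ler_wpM2r ?kernel_self_ge0 // ler_nat.
(* With [x = (b, c)]: at each coordinate [(b, c)] is either [(a, d)] or [(d, a)], and comparing [b]
   with [a] tells which. *)
have DE x r : D x -> (val x.1 r = val a r /\ val x.2 r = val d r) \/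
    [/\ val a r != val x.1 r, val x.1 r = val d r & val x.2 r = val a r].
  move=> /andP[_ /eqP/ffunP/(_ r)]; rewrite !ffunE /=.
  case: eqP => [-> | ne1]; case: eqP => [-> | ne2].
  - by left.
  - by move=> [e1 e2]; case: ne2; rewrite -e1 -e2.
  - by move=> [e1 e2]; case: ne1; rewrite e1 e2.
  - by move=> [-> ->]; right; split=> //; apply/eqP.
apply: (@leq_trans (k ^ #|supp a :|: supp d|)); last first.
  by rewrite leq_pexp2l ?card_supp2 //; apply: leq_ltn_trans (ltn_ord z).
apply: (@card_le_supported _ _ (fun x : A * A => val x.1)) => [x y Dx Dy e|x r Dx].
  apply/eqP; rewrite -pair_eqE /pair_eq /= -!val_eqE /= e eqxx /=.
  apply/eqP/ffunP => r.
  case: (DE _ r Dx) => -[]; case: (DE _ r Dy) => -[].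
  - by move=> _ -> _ ->.
  - by move=> ne _ _ ex _; rewrite -e ex eqxx in ne.
  - by move=> ey _ ne _ _; rewrite e ey eqxx in ne.
  - by move=> _ _ -> _ _ ->.
rewrite inE negb_or !inE !negbK => /andP[/eqP az /eqP dz].
by case: (DE _ r Dx) => -[]; rewrite ?az ?dz.
Qed.

End Swap.
End MultiIndices.

(** * Comparison of two codes on pairs of multi-indices *)

Section Moments4.
Variables (R k l : nat) (z : 'I_k).
Hypothesis z0 : nat_of_ord z = 0%N.
Local Notation A := (Alpha R k l).
Local Notation Key := {ffun 'I_R -> 'I_k * 'I_k}.

Definition key4 (J : finType) (c : 'I_k -> J -> bool) (u v : Key) : bool :=
  [forall r, even4 c (u r).1 (u r).2 (v r).1 (v r).2].

Definition index4 (J : finType) (c : 'I_k -> J -> bool) (p q : A * A) : bool :=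
  [forall r, even4 c (val p.1 r) (val p.2 r) (val q.1 r) (val q.2 r)].

Section OneCode.
Variables (J : finType) (c : 'I_k -> J -> bool).
Hypothesis c_inj : forall i j, c i =1 c j -> i = j.

(** Where one pair has equal entries, the relation says that the other pair has equal entries too,
    and erasure preserves both equality and inequality of entries. *)
Lemma index4_key p q : index4 c p q = key4 c (key z p) (key z q).
Proof.
apply: eq_forallb => r; rewrite !ffunE.
case: eqP => [->|_]; case: eqP => [->|_] //=.
- by rewrite !even4_diag // !eqxx.
- by rewrite !even4_diag.
- by rewrite !(even4E c _ _ _ z) !(even4E c _ _ _ (val q.2 r)) !even4_diag.
Qed.

Lemma key4_sym u v : key4 c u v = key4 c v u.
Proof. by apply: eq_forallb => r; rewrite even4E. Qed.

(** The first entries of [v] determine the second ones. Off the supports of [p] the entries of [v]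
    must agree, and for a key attained by a pair this forces [(z, z)]; without attainment every
    [(i, i)] would be allowed there. *)
Lemma card_key4 (p : A * A) :
  (#|[pred v | [exists q : A * A, key z q == v] && key4 c (key z p) v]| <= k ^ (2 * l))%N.
Proof.
apply: (@leq_trans (k ^ #|supp z p.1 :|: supp z p.2|)); last first.
  by rewrite leq_pexp2l ?card_supp2 //; apply: leq_ltn_trans (ltn_ord z).
apply: (@card_le_supported R k z _ _ (fun v : Key => [ffun r => (v r).1])).
  move=> u v /andP[_ /forallP Hu] /andP[_ /forallP Hv] /ffunP e.
  apply/ffunP => r; have := e r; rewrite !ffunE => e1.
  rewrite [LHS]surjective_pairing [RHS]surjective_pairing e1; congr (_, _).
  by apply: (even4_uniq c_inj (Hu r)); rewrite e1.
move=> v r /andP[/existsP[q /eqP <-] /forallP/(_ r)].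
rewrite !inE negb_or !negbK => H /andP[/eqP p1 /eqP p2]; move: H.
rewrite !ffunE p1 p2 eqxx /= even4_diag //.
by case: (eqVneq (val q.1 r) (val q.2 r)) => [//|/negbTE /= ->].
Qed.

End OneCode.

(* Two pairs that both contain [z] share an entry, and then every code requires
   the two remaining entries to agree. *)
Lemma key4_differ (J J' : finType) (c : 'I_k -> J -> bool) (c' : 'I_k -> J' -> bool) u v :
  (forall i j, c i =1 c j -> i = j) -> (forall i j, c' i =1 c' j -> i = j) ->
  key4 c u v != key4 c' u v -> doubly z u || doubly z v.
Proof.
move=> ci ci'; apply: contraR; rewrite negb_or => /andP[/existsPn Hu /existsPn Hv].
apply/eqP; apply: eq_forallb => r; move: (Hu r) (Hv r); rewrite !negb_and !negbK.
case: (u r) (v r) => [i j] [i' j'] /=.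
move=> /orP[]/eqP-> /orP[]/eqP->.
- by rewrite !even4_common.
- by rewrite (even4E c) (even4E c') (even4_swap c) (even4_swap c') !even4_common.
- by rewrite (even4_swap c) (even4_swap c') !even4_common.
- rewrite (even4_swap c) (even4_swap c') (even4E c) (even4E c').
  by rewrite (even4_swap c) (even4_swap c') !even4_common.
Qed.

Variables (F : realType) (T : A * A -> A * A -> F).
Hypothesis Tsym : forall p q, T p q = T q p.
Hypothesis Trot : forall a b c d, T (a, b) (c, d) = T (a, d) (b, c).
Hypothesis Tpsd : forall c : A * A -> F, 0 <= \sum_p \sum_q c p * c q * T p q.

Lemma invariance_form (J J' : finType) (c : 'I_k -> J -> bool) (c' : 'I_k -> J' -> bool) :
  (1 < k)%N -> (0 < l)%N ->
  (forall i j, c i =1 c j -> i = j) -> (forall i j, c' i =1 c' j -> i = j) ->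
  \sum_a \sum_d T (a, d) (a, d) <= 1 ->
  `| \sum_p \sum_q ((index4 c p q)%:R - (index4 c' p q)%:R) * T p q |
    <= (k ^ (6 * l))%:R * Num.sqrt (\sum_a \sum_(d | meet z a d) T (a, d) (a, d)).
Proof.
move=> k1 l0 ci ci' T1.
pose E u v : F := (key4 c u v)%:R - (key4 c' u v)%:R.
under eq_bigr do under eq_bigr do rewrite !index4_key // -/(E _ _).
set tau := \sum_a \sum_(d | meet z a d) _.
have tau0 : 0 <= tau by apply: sumr_ge0 => a _; apply: sumr_ge0 => d _; exact: kernel_self_ge0.
pose K : F := (k ^ (2 * l))%:R.
have K0 : 0 <= K by rewrite ler0n.
(* Row sums cost [2 * K], one [K] per code; the diagonal blocks cost another [K], and the choice of
   the weight a factor 2. Each 2 is at most [k ^ l], whence the exponent [6 * l]. *)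
apply: (@le_trans _ _ (2 * (2 * K * K) * Num.sqrt tau)); last first.
  rewrite ler_wpM2r ?sqrtr_ge0 // /K -!natrM ler_nat.
  rewrite (_ : 6 * l = l + l + 2 * l + 2 * l)%N; last by lia.
  rewrite !expnD !mulnA !leq_mul // -[leqLHS]muln1 ?leq_mul ?expn_gt0 //.
  - by rewrite muln1 -(prednK l0) expnS (leq_trans k1) // leq_pmulr // expn_gt0 (ltnW k1).
  - by rewrite muln1 -(prednK l0) expnS (leq_trans k1) // leq_pmulr // expn_gt0 (ltnW k1).
apply: le_sqrt_of_weighted => // [|x x0]; first by rewrite !mulr_ge0.
have Wle (p : A * A) : \sum_(v | [exists q : A * A, key z q == v]) `|E (key z p) v| <= 2 * K.
  pose n (J0 : finType) (c0 : 'I_k -> J0 -> bool) : F :=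
    \sum_(v | [exists q : A * A, key z q == v]) (key4 c0 (key z p) v)%:R.
  have nle (J0 : finType) (c0 : 'I_k -> J0 -> bool) :
      (forall i j, c0 i =1 c0 j -> i = j) -> n J0 c0 <= K.
    move=> c0i; rewrite /n -natr_sum ler_nat.
    apply: leq_trans (card_key4 c0i p); rewrite -sum1_card.
    under [leqRHS]eq_bigl do rewrite inE.
    by rewrite big_mkcondr /=; apply: leq_sum => v _; case: key4.
  apply: (@le_trans _ _ (n _ c + n _ c')); last by have := nle _ _ ci; have := nle _ _ ci'; lra.
  rewrite /n -big_split /=; apply: ler_sum => v _.
  by rewrite (le_trans (ler_normB _ _)) // !normr_nat.
have EI (u v : Key) : E u v != 0 -> doubly z u || doubly z v.
  move=> H; apply: (key4_differ ci ci'); apply: contraNneq H => e.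
  by rewrite /E e subrr.
have Esym (u v : Key) : E u v = E v u by rewrite /E !(key4_sym _ u).
have W0 : 0 <= 2 * K by lra.
apply: (le_trans (block_form_le (key := @key R k l z) Tsym Tpsd W0 Esym EI Wle x0)).
rewrite -!mulrA ler_wpM2l //; rewrite ler_wpM2l // mulrDr.
have xi0 : 0 <= x^-1 by rewrite invr_ge0 ltW.
apply: lerD.
  rewrite mulrCA ler_wpM2l ?(ltW x0) //.
  (* At a coordinate where the common key has two nonzero entries, the first is the entry of [a] and
     the second that of [d], so the supports meet. *)
  apply: (sum_block_le z0 Tsym Trot Tpsd) => a b e d /ffunP H /existsP[r].
  have := H r; rewrite !ffunE /=.
  case: eqP => [_ _|_]; first by rewrite eqxx.
  case: eqP => [_ [-> _]|_ [_ ->]]; first by rewrite eqxx.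
  by move=> /andP[ar dr]; apply/existsP; exists r; rewrite !inE ar dr.
(* The sum over all keys needs no restriction on [(a, d)] and is paid for by the norm bound [T1]. *)
rewrite mulrC ler_wpM2r //.
apply: (le_trans (sum_block_le z0 Tsym Trot Tpsd (I := predT) (Q := fun _ _ => true) _)) => //.
by rewrite -[leRHS]mulr1 ler_wpM2l.
Qed.

End Moments4.

(** * Expansion of the polynomials and moments under the pseudo-expectation *)

Section Polynomials.
Variables (F : realType) (R k l : nat).
Local Notation A := (Alpha R k l).

Definition mono2 (p : A * A) : FPoly F R k l := fhat F p.1 * fhat F p.2.

(** The fourth power is expanded as a product of two squares, each a sum over pairs. Independence of
    the coordinates turns the average into a product of one-coordinate moments, each 0 or 1. *)
Lemma average_f4 (J Om : finType) (c : 'I_k -> J -> bool)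
    (s : Om -> {ffun J -> bool}) (zv : Om -> 'I_k -> F) :
  bijective s ->
  (forall y i, zv y i = (-1) ^+ (\sum_j c i j * s y j)%N) ->
  ((#|Om| ^ R)%N%:R)^-1 *:
    \sum_(x : {ffun 'I_R -> Om}) (f_on l (fun r i => zv (x r) i)) ^+ 4
  = \sum_p \sum_q (index4 c p q)%:R *: (mono2 p * mono2 q).
Proof.
move=> bs zE.
have f2 (x : {ffun 'I_R -> Om}) : (f_on l (fun r i => zv (x r) i)) ^+ 2
   = \sum_(p : A * A) (\prod_r (zv (x r) (val p.1 r) * zv (x r) (val p.2 r))) *: mono2 p.
  rewrite expr2 /f_on big_distrlr /= pair_bigA /=; apply: eq_bigr => p _.
  by rewrite -scalerAl -scalerAr scalerA big_split.
under eq_bigr do rewrite -[4%N]/(2 * 2)%N exprM f2 expr2 big_distrlr /=.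
rewrite exchange_big /= scaler_sumr; apply: eq_bigr => p _.
rewrite exchange_big /= scaler_sumr; apply: eq_bigr => q _.
under eq_bigr do rewrite -scalerAl -scalerAr scalerA -big_split /=.
rewrite -scaler_suml scalerA; congr (_ *: _).
rewrite -(bigA_distr_bigA (fun r y => zv y (val p.1 r) * zv y (val p.2 r) *
   (zv y (val q.1 r) * zv y (val q.2 r)))) /=.
rewrite natrX -exprVn -[X in _ ^+ X]card_ord -prodr_const -big_split /=.
under eq_bigr do under eq_bigr do rewrite !zE.
under eq_bigr do rewrite (moment4 F c _ _ _ _ bs).
rewrite /index4; case: forallP => [H|/forallP].
  by rewrite big1 // => r _; rewrite H.
rewrite negb_forall => /existsP[r /negbTE Hr].
by rewrite (bigD1 r) //= Hr mul0r.
Qed.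

(** [msize] is the degree plus one, so degrees add in this shifted form. Such bounds are needed
    throughout because [L] is linear only up to degree 4. *)
Lemma msizeM_leS n (p q : {mpoly F[n]}) (a b : nat) :
  (msize p <= a.+1 -> msize q <= b.+1 -> msize (p * q) <= (a + b).+1)%N.
Proof.
have [->|p0] := eqVneq p 0; first by rewrite mul0r msize0.
have [->|q0] := eqVneq q 0; first by rewrite mulr0 msize0.
by rewrite msizeM //; move: (msize p) (msize q) => x y; lia.
Qed.

Lemma msize_sum_le n (I : Type) (r : seq I) (P : pred I) (G : I -> {mpoly F[n]}) m :
  (forall i, msize (G i) <= m)%N -> (msize (\sum_(i <- r | P i) G i) <= m)%N.
Proof.
move=> HG; apply: (big_ind (fun p => msize p <= m)%N) => [|p q pm qm|//].
  by rewrite msize0.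
by rewrite (leq_trans (msizeD_le _ _)) // geq_max pm qm.
Qed.

Lemma msize_fhat (a : A) : msize (fhat F a) = 2.
Proof. by rewrite msizeX mdeg1. Qed.

Lemma msize_mono2 p : (msize (mono2 p) <= 3)%N.
Proof. by apply: (@msizeM_leS _ _ _ 1 1); rewrite msize_fhat. Qed.

Variable L : FPoly F R k l -> F.
Hypothesis HL : pseudo_exp4 L.

Lemma pseudo_exp0 : L 0 = 0.
Proof. by case: HL => _ LZ _ _; rewrite -(scale0r 0) LZ ?mul0r ?msize0. Qed.

Lemma pseudo_exp_sum (I : Type) (r : seq I) (P : pred I) (G : I -> FPoly F R k l) :
  (forall i, (msize (G i) <= 5)%N) ->
  L (\sum_(i <- r | P i) G i) = \sum_(i <- r | P i) L (G i).
Proof.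
move=> HG; elim: r => [|i r IH]; first by rewrite !big_nil pseudo_exp0.
rewrite !big_cons -IH; case: (P i) => //.
case: HL => LD _ _ _; rewrite LD //.
exact: msize_sum_le.
Qed.

Definition pmoment (p q : A * A) : F := L (mono2 p * mono2 q).

Lemma msize_mono4 p q : (msize (mono2 p * mono2 q) <= 5)%N.
Proof. by apply: (@msizeM_leS _ _ _ 2 2); apply: msize_mono2. Qed.

Lemma pseudo_exp_mono4 (I J : finType) (w : I -> J -> F)
    (p : I -> A * A) (q : J -> A * A) :
  L (\sum_i \sum_j w i j *: (mono2 (p i) * mono2 (q j)))
  = \sum_i \sum_j w i j * pmoment (p i) (q j).
Proof.
have sw i j : (msize (w i j *: (mono2 (p i) * mono2 (q j))) <= 5)%N.
  by rewrite (leq_trans (msizeZ_le _ _)) ?msize_mono4.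
rewrite pseudo_exp_sum => [|i]; last first.
  exact: msize_sum_le.
apply: eq_bigr => i _; rewrite pseudo_exp_sum //; apply: eq_bigr => j _.
by case: HL => _ LZ _ _; rewrite LZ ?msize_mono4.
Qed.

Lemma pmoment_sym p q : pmoment p q = pmoment q p.
Proof. by rewrite /pmoment mulrC. Qed.

Lemma pmoment_rot a b c d : pmoment (a, b) (c, d) = pmoment (a, d) (b, c).
Proof. by rewrite /pmoment /mono2 /=; congr L; ring. Qed.

(** The form is [L] of the square of the quadratic polynomial [sum_p c p f_a f_b], with
    [p = (a, b)]. *)
Lemma pmoment_psd (c : A * A -> F) : 0 <= \sum_p \sum_q c p * c q * pmoment p q.
Proof.
rewrite -(pseudo_exp_mono4 (fun p q => c p * c q) id id) /=.
have -> : \sum_p \sum_q (c p * c q) *: (mono2 p * mono2 q)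
   = (\sum_p c p *: mono2 p) * (\sum_p c p *: mono2 p).
  rewrite big_distrlr /=; apply: eq_bigr => p _; apply: eq_bigr => q _.
  by rewrite -scalerAl -scalerAr scalerA.
case: HL => _ _ _; apply.
apply: msize_sum_le => p.
by rewrite (leq_trans (msizeZ_le _ _)) ?msize_mono2.
Qed.

Lemma sqr_fhatM (a d : A) : fhat F a ^+ 2 * fhat F d ^+ 2 = mono2 (a, d) * mono2 (a, d).
Proof. by rewrite /mono2 /=; ring. Qed.

Lemma pseudo_exp_sqr_sum (P : pred A) :
  L ((\sum_(a | P a) fhat F a ^+ 2) ^+ 2)
  = \sum_(a | P a) \sum_(d | P d) pmoment (a, d) (a, d).
Proof.
rewrite expr2 big_distrlr /=.
under eq_bigr do under eq_bigr do rewrite sqr_fhatM.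
rewrite pseudo_exp_sum => [|a]; last first.
  by apply: msize_sum_le => d; apply: msize_mono4.
by apply: eq_bigr => a _; rewrite pseudo_exp_sum // => d; apply: msize_mono4.
Qed.

(** Expanding the squared influences counts [(a, d)] once for each coordinate common to both
    supports, hence at least once if they meet; the diagonal moments are nonnegative. *)
Lemma sum_meet_le (z : 'I_k) : nat_of_ord z = 0%N ->
  \sum_(a : A) \sum_(d | meet z a d) pmoment (a, d) (a, d)
    <= L (\sum_(r < R) f_Inf F k l r ^+ 2).
Proof.
move=> z0; rewrite pseudo_exp_sum => [|r]; last first.
  have H : (msize (f_Inf F k l r) <= 3)%N.
    by apply: msize_sum_le => a; apply: (msize_mono2 (a, a)).
  by rewrite expr2; apply: (@msizeM_leS _ _ _ 2 2).
under [leRHS]eq_bigr do rewrite pseudo_exp_sqr_sum big_mkcond.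
rewrite exchange_big /=; apply: ler_sum => a _.
rewrite big_mkcond.
have -> : \sum_(r < R) (if nat_of_ord (val a r) != 0%N then
     \sum_(d : A | nat_of_ord (val d r) != 0%N) pmoment (a, d) (a, d) else 0)
   = \sum_(d : A) \sum_(r < R) ((r \in supp z a) && (r \in supp z d))%:R * pmoment (a, d) (a, d).
  rewrite exchange_big /=; apply: eq_bigr => r _; rewrite !in_supp //.
  case: (_ != _); last by rewrite big1 // => d _; rewrite mul0r.
  rewrite big_mkcond; apply: eq_bigr => d _; rewrite in_supp //=.
  by case: ifP; rewrite ?mul1r ?mul0r.
apply: ler_sum => d _.
have N0 := kernel_self_ge0 pmoment_psd a d.
have pos r : 0 <= ((r \in supp z a) && (r \in supp z d))%:R * pmoment (a, d) (a, d).
  by rewrite mulr_ge0 ?ler0n.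
case: ifP => [/existsP[r Hr]|_]; last exact: sumr_ge0.
by rewrite (bigD1 r) //= Hr mul1r lerDl; apply: sumr_ge0.
Qed.

End Polynomials.

(** * The codes of the two ensembles *)

Section Codes.
Variables (t k : nat).

Definition bits (y : 'I_(2 ^ t)) (j : 'I_t) : bool := odd (y %/ 2 ^ j).

(** Induction on the number of bits: the higher bits determine the half, bit 0 the parity. *)
Lemma bits_inj (i j : 'I_(2 ^ t)) : bits i =1 bits j -> i = j.
Proof.
move=> H; apply: val_inj => /=.
have {}H (s : nat) : (s < t)%N -> odd (i %/ 2 ^ s) = odd (j %/ 2 ^ s).
  by move=> st; apply: (H (Ordinal st)).
move: (ltn_ord i) (ltn_ord j) H; move: (nat_of_ord i) (nat_of_ord j).
elim: t => [|n IH] a b; first by rewrite expn0; lia.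
move=> an bn H.
have ha : (a./2 < 2 ^ n)%N by move: an; rewrite expnS; lia.
have hb : (b./2 < 2 ^ n)%N by move: bn; rewrite expnS; lia.
have e : a./2 = b./2.
  apply: IH => // s sn; have := H s.+1; rewrite ltnS => /(_ sn).
  by rewrite expnS !divnMA !divn2.
by have := H 0%N isT; rewrite expn0 !divn1 -(odd_double_half a) -(odd_double_half b) e;
   rewrite !oddD !odd_double !addbF !oddb => ->.
Qed.

(** Zero vector for the symbol 0, unit vector for any other symbol: the former gives the constant 1,
    the latter independent signs. *)
Definition nonzero_code (i j : 'I_k) : bool := (nat_of_ord i != 0%N) && (i == j).

Lemma nonzero_code_inj (i j : 'I_k) : nonzero_code i =1 nonzero_code j -> i = j.
Proof.
move=> H; have := H i; have := H j; rewrite /nonzero_code !eqxx !andbT.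
case: (nat_of_ord i =P _) => i0; case: (nat_of_ord j =P _) => j0 //=; last by move=> /eqP.
by move=> _ _; apply: val_inj; rewrite /= i0 j0.
Qed.

End Codes.

(** * Both ensembles as codes, and the invariance theorem *)

Lemma chiE (F : realType) (t : nat) (i y : 'I_(2 ^ t)) :
  chi F i y = (-1) ^+ (\sum_j bits i j * [ffun j => bits y j] j)%N.
Proof. by rewrite /chi; congr (_ ^+ _); apply: eq_bigr => j _; rewrite ffunE. Qed.

Lemma YvalE (F : realType) (k : nat) (y : {ffun 'I_k -> bool}) (i : 'I_k) :
  Yval F (y i) i = (-1) ^+ (\sum_j nonzero_code i j * y j)%N.
Proof.
rewrite /Yval (bigD1 i) //= big1 ?addn0.
  by rewrite /nonzero_code eqxx andbT; case: eqP; rewrite ?mul0n ?mul1n.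
by move=> j ji; rewrite /nonzero_code (eq_sym i) (negbTE ji) andbF mul0n.
Qed.

Lemma EX_f4E (F : realType) (t R l : nat) :
  EX_f4 F t R l = \sum_p \sum_q (index4 (@bits t) p q)%:R *: (mono2 F p * mono2 F q).
Proof.
have bb : bijective (fun y : 'I_(2 ^ t) => [ffun j => bits y j]).
  apply: inj_card_bij; last by rewrite card_ffun card_bool !card_ord.
  by move=> a b /ffunP H; apply: bits_inj => j; have := H j; rewrite !ffunE.
by rewrite -(average_f4 R l bb (fun y i => chiE F i y)) card_ord.
Qed.

Lemma EY_f4E (F : realType) (R k l : nat) :
  EY_f4 F R k l = \sum_p \sum_q (index4 (@nonzero_code k) p q)%:R *: (mono2 F p * mono2 F q).
Proof.
have bb : bijective (id : {ffun 'I_k -> bool} -> _) by exists id.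
rewrite -(average_f4 R l bb (fun y i => YvalE F y i)) card_ffun card_bool card_ord.
by rewrite -expnM mulnC.
Qed.

Theorem theorem6p2 :
  exists C0 : nat,
  forall (F : realType) (t R l : nat), (0 < t)%N -> (0 < R)%N -> (0 < l)%N ->
  forall L : FPoly F R (2 ^ t) l -> F,
    pseudo_exp4 L ->
    L (f_normsq F R (2 ^ t) l ^+ 2) <= 1 ->
    `| L (EX_f4 F t R l) - L (EY_f4 F R (2 ^ t) l) |
      <= ((2 ^ t) ^ (C0 * l))%N%:R
         * Num.sqrt (L (\sum_(r < R) f_Inf F (2 ^ t) l r ^+ 2)).
Proof.
exists 6%N => F t R l t0 _ l0 L HL norm1.
have k1 : (1 < 2 ^ t)%N by rewrite -(expn0 2) ltn_exp2l.
pose z : 'I_(2 ^ t) := Ordinal (ltnW k1).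
have z0 : nat_of_ord z = 0%N by [].
rewrite pseudo_exp_sqr_sum // in norm1.
rewrite EX_f4E EY_f4E !(pseudo_exp_mono4 HL _ id id) -sumrB.
under eq_bigr do rewrite -sumrB.
under eq_bigr do under eq_bigr do rewrite -mulrBl.
have := invariance_form z0 (@pmoment_sym _ _ _ _ L) (@pmoment_rot _ _ _ _ L)
  (pmoment_psd HL) k1 l0 (@bits_inj t) (@nonzero_code_inj _) norm1.
move/le_trans; apply; rewrite ler_wpM2l // ler_wsqrtr //.
exact: sum_meet_le.
Qed.
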